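(* Let $H$ be a weak Hopf algebra and $B$ an algebra in $\mathsf{C}$, let $\varphi_B:H\otimes B\to B$ be a measuring such that $\nabla^{\varphi_B}_{B\otimes H}\circ(B\otimes\eta_H)=P_{\varphi_B}\circ(\eta_H\otimes B)$, and let $\sigma:H\otimes H\to B$ be a morphism such that $\sigma\ast u_2^{\varphi_B}=\sigma$. Assume that the quadruple $(B,H,P_{\varphi_B},F_\sigma)$ satisfies the twisted and the cocycle conditions $$(\mu_B\otimes H)\circ(B\otimes P_{\varphi_B})\circ(F_\sigma\otimes B)=(\mu_B\otimes H)\circ(B\otimes F_\sigma)\circ(P_{\varphi_B}\otimes H)\circ(H\otimes P_{\varphi_B}),$$ $$(\mu_B\otimes H)\circ(B\otimes F_\sigma)\circ(F_\sigma\otimes H)=(\mu_B\otimes H)\circ(B\otimes F_\sigma)\circ(P_{\varphi_B}\otimes H)\circ(H\otimes F_\sigma).$$ Then the following statements are equivalent: (i) The product $\mu_{B\otimes_{\varphi_B}^{\sigma}H}$ is associative with preunit $\nu=\nabla^{\varphi_B}_{B\otimes H}\circ(\eta_B\otimes\eta_H)$ and normalized with respect to $\nabla^{\varphi_B}_{B\otimes H}$. (ii) The morphism $\sigma$ satisfies the twisted condition $\mu_B\circ(B\otimes\sigma)\circ(P_{\varphi_B}\otimes H)\circ(H\otimes P_{\varphi_B})=\mu_B\circ(B\otimes\varphi_B)\circ(F_\sigma\otimes B)$, the cocycle condition $\mu_B\circ(B\otimes\sigma)\circ(P_{\varphi_B}\otimes H)\circ(H\otimes F_\sigma)=\mu_B\circ(B\otimes\sigma)\circ(F_\sigma\otimes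 H)$, and the normal condition $\sigma\circ(\eta_H\otimes H)=\sigma\circ(H\otimes\eta_H)=u_1^{\varphi_B}$.
   Context: Category. $\mathsf{C}$ is a strict symmetric monoidal category with tensor product $\otimes$, unit object $K$ and symmetry $c$, in which every idempotent splits. For an object $M$ and a morphism $f$, $M\otimes f$ and $f\otimes M$ mean $id_M\otimes f$ and $f\otimes id_M$. Algebras $(A,\eta_A,\mu_A)$ are unital and associative, coalgebras $(D,\varepsilon_D,\delta_D)$ counital and coassociative; $\delta_{D\otimes E}=(D\otimes c_{D,E}\otimes E)\circ(\delta_D\otimes\delta_E)$. For $f,g:D\to A$ the convolution is $f\ast g=\mu_A\circ(f\otimes g)\circ\delta_D$. Weak Hopf algebra. An object $H$ with algebra structure $(\eta_H,\mu_H)$ and coalgebra structure $(\varepsilon_H,\delta_H)$ such that: (a1) $\delta_H\circ\mu_H=(\mu_H\otimes\mu_H)\circ\delta_{H\otimes H}$; (a2) $\varepsilon_H\circ\mu_H\circ(\mu_H\otimes H)=((\varepsilon_H\circ\mu_H)\otimes(\varepsilon_H\circ\mu_H))\circ(H\otimes\delta_H\otimes H)=((\varepsilon_H\circ\mu_H)\otimes(\varepsilon_H\circ\mu_H))\circ(H\otimes(c_{H,H}\circ\delta_H)\otimes H)$; (a3) $(\delta_H\otimes H)\circ\delta_H\circ\eta_H=(H\otimes\mu_H\otimes H)\circ((\delta_H\circ\eta_H)\otimes(\delta_H\circ\eta_H))=(H\otimes(\mu_H\circ c_{H,H})\otimes H)\circ((\delta_H\circ\eta_H)\otimes(\delta_H\circ\eta_H))$;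 and there is an antipode $\lambda_H:H\to H$ with (a4) $id_H\ast\lambda_H=((\varepsilon_H\circ\mu_H)\otimes H)\circ(H\otimes c_{H,H})\circ((\delta_H\circ\eta_H)\otimes H)$, (a5) $\lambda_H\ast id_H=(H\otimes(\varepsilon_H\circ\mu_H))\circ(c_{H,H}\otimes H)\circ(H\otimes(\delta_H\circ\eta_H))$, (a6) $\lambda_H\ast id_H\ast\lambda_H=\lambda_H$. Measurings. A measuring is a morphism $\varphi_B:H\otimes B\to B$ with $\varphi_B\circ(H\otimes\mu_B)=\mu_B\circ(\varphi_B\otimes\varphi_B)\circ(H\otimes c_{H,B}\otimes B)\circ(\delta_H\otimes B\otimes B)$. Put $u_1^{\varphi_B}=\varphi_B\circ(H\otimes\eta_B)$, $u_2^{\varphi_B}=\varphi_B\circ(\mu_H\otimes\eta_B)$, $P_{\varphi_B}=(\varphi_B\otimes H)\circ(H\otimes c_{H,B})\circ(\delta_H\otimes B)$ and $F_\sigma=(\sigma\otimes\mu_H)\circ\delta_{H\otimes H}$. The morphism $\nabla^{\varphi_B}_{B\otimes H}=(\mu_B\otimes H)\circ(B\otimes P_{\varphi_B})\circ(B\otimes H\otimes\eta_B)$ is idempotent. Product and preunit. $\mu_{B\otimes_{\varphi_B}^{\sigma}H}=(\mu_B\otimes H)\circ(\mu_B\otimes F_\sigma)\circ(B\otimes P_{\varphi_B}\otimes H)$. It is normalized with respect to $\nabla=\nabla^{\varphi_B}_{B\otimes H}$ if $\nabla\circ\mu_{B\otimes_{\varphi_B}^{\sigma}H}=\mu_{B\otimes_{\varphi_B}^{\sigma}H}=\mu_{B\otimes_{\varphi_B}^{\sigma}H}\circ(\nabla\otimes\nabla)$.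 A preunit for it is a morphism $\nu:K\to B\otimes H$ with $\mu_{B\otimes_{\varphi_B}^{\sigma}H}\circ(B\otimes H\otimes\nu)=\mu_{B\otimes_{\varphi_B}^{\sigma}H}\circ(\nu\otimes B\otimes H)=\nabla$ and $\nu=\mu_{B\otimes_{\varphi_B}^{\sigma}H}\circ(\nu\otimes\nu)$. *)

(* Defs.v *)
From mathcomp Require Import all_boot.

Set Implicit Arguments.
Unset Strict Implicit.
Unset Printing Implicit Defensive.

Declare Scope smc_scope.
Delimit Scope smc_scope with smc.

(* Strictness is an equality between objects, so the laws comparing morphisms
   along it are stated up to transport of the source and the target. *)
Definition cast_hom (O : Type) (hom : O -> O -> Type) (A A' D D' : O)
    (eA : A = A') (eD : D = D') (f : hom A D) : hom A' D' :=
  eq_rect A (fun X => hom X D') (eq_rect D (fun Y => hom A Y) f D' eD) A' eA.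

Record strict_smc : Type := StrictSMC {
  obj :> Type;
  hom : obj -> obj -> Type;
  idm : forall A, hom A A;
  compm : forall A B D, hom B D -> hom A B -> hom A D;
  compm_idl : forall A B (f : hom A B), compm (idm B) f = f;
  compm_idr : forall A B (f : hom A B), compm f (idm A) = f;
  compmA : forall A B D E (h : hom D E) (g : hom B D) (f : hom A B),
    compm h (compm g f) = compm (compm h g) f;

  unit_obj : obj;
  tens : obj -> obj -> obj;
  tensA : forall A B D, tens A (tens B D) = tens (tens A B) D;
  tens1o : forall A, tens unit_obj A = A;
  tenso1 : forall A, tens A unit_obj = A;
  tensm : forall A A' B B',
    hom A A' -> hom B B' -> hom (tens A B) (tens A' B');
  tensm_id : forall A B, tensm (idm A) (idm B) = idm (tens A B);
  tensm_comp : forall A A' A'' B B' B''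
      (f' : hom A' A'') (f : hom A A') (g' : hom B' B'') (g : hom B B'),
    tensm (compm f' f) (compm g' g) = compm (tensm f' g') (tensm f g);
  tensmA : forall A A' B B' D D'
      (f : hom A A') (g : hom B B') (h : hom D D'),
    cast_hom (tensA A B D) (tensA A' B' D') (tensm f (tensm g h)) =
    tensm (tensm f g) h;
  tensm1l : forall A A' (f : hom A A'),
    cast_hom (tens1o A) (tens1o A') (tensm (idm unit_obj) f) = f;
  tensm1r : forall A A' (f : hom A A'),
    cast_hom (tenso1 A) (tenso1 A') (tensm f (idm unit_obj)) = f;

  sym : forall A B, hom (tens A B) (tens B A);
  sym_natural : forall A A' B B' (f : hom A A') (g : hom B B'),
    compm (sym A' B') (tensm f g) = compm (tensm g f) (sym A B);
  symK : forall A B, compm (sym B A) (sym A B) = idm (tens A B);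
  (* c_{A, B ⊗ D} = (B ⊗ c_{A, D}) ∘ (c_{A, B} ⊗ D) *)
  sym_hexagon : forall A B D,
    sym A (tens B D) =
    compm (cast_hom (erefl _) (tensA B D A) (tensm (idm B) (sym A D)))
         (cast_hom (esym (tensA A B D)) (esym (tensA B A D))
                   (tensm (sym A B) (idm D)))
}.

Definition idempotents_split (C : strict_smc) : Prop :=
  forall (A : C) (e : hom A A), compm e e = e ->
  exists (S : C) (i : hom S A) (p : hom A S),
    compm i p = e /\ compm p i = idm S.

(* Morphisms between iterated tensor products are typed by words of objects:
   [mor [:: A; B] [:: D]] is, definitionally, [hom (tens A B) D], and
   [mor [::] [:: A]] is [hom unit_obj A].  As concatenation of explicit words
   computes, no bracketing of tensor products and no transport along [tensA],
   [tens1o], [tenso1] shows up in formulas. *)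
Fixpoint tens_word (C : strict_smc) (w : seq C) : C :=
  if w is A :: w' then
    (if w' is [::] then A else tens A (tens_word w'))
  else unit_obj C.

Lemma tens_word_cat (C : strict_smc) (v w : seq C) :
  tens_word (v ++ w) = tens (tens_word v) (tens_word w).
Proof.
elim: v => [|A v IHv]; first by rewrite /= tens1o.
case: v IHv => [|B v] IHv.
  by case: w {IHv} => [|D w] //=; rewrite tenso1.
rewrite -[LHS]/(tens A (tens_word ((B :: v) ++ w))) IHv.
by rewrite -[tens_word (A :: _)]/(tens A (tens_word (B :: v))) tensA.
Qed.

Definition mor (C : strict_smc) (v w : seq C) : Type :=
  hom (tens_word v) (tens_word w).

Definition mor_id (C : strict_smc) (A : C) : mor [:: A] [:: A] := idm A.

Definition mor_comp (C : strict_smc) (u v w : seq C)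
  (g : mor v w) (f : mor u v) : mor u w := compm g f.

Definition mor_tens (C : strict_smc) (v v' w w' : seq C)
    (f : mor v v') (g : mor w w') : mor (v ++ w) (v' ++ w') :=
  cast_hom (esym (tens_word_cat v w)) (esym (tens_word_cat v' w'))
           (tensm f g).

Definition mor_sym (C : strict_smc) (A B : C) : mor [:: A; B] [:: B; A] :=
  sym A B.

Notation "\id_ A" := (mor_id A) (at level 8, A at level 2) : smc_scope.
Notation "\c_( A , B )" := (mor_sym A B) (at level 8) : smc_scope.
Notation "f ⊗ g" := (mor_tens f g) (at level 40, left associativity)
  : smc_scope.
Notation "g ∘ f" := (mor_comp g f) (at level 45, right associativity)
  : smc_scope.
Local Open Scope smc_scope.

Record algebra (C : strict_smc) (A : C) : Type := Algebra {
  eta : mor [::] [:: A];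
  mu : mor [:: A; A] [:: A];
  mu_etal : mu ∘ (eta ⊗ \id_A) = \id_A;
  mu_etar : mu ∘ (\id_A ⊗ eta) = \id_A;
  muA : mu ∘ (mu ⊗ \id_A) = mu ∘ (\id_A ⊗ mu)
}.

Record coalgebra (C : strict_smc) (D : C) : Type := Coalgebra {
  eps : mor [:: D] [::];
  delta : mor [:: D] [:: D; D];
  eps_deltal : (eps ⊗ \id_D) ∘ delta = \id_D;
  eps_deltar : (\id_D ⊗ eps) ∘ delta = \id_D;
  deltaA : (delta ⊗ \id_D) ∘ delta = (\id_D ⊗ delta) ∘ delta
}.

Definition delta_tens (C : strict_smc) (D E : C)
    (cD : coalgebra D) (cE : coalgebra E) : mor [:: D; E] [:: D; E; D; E] :=
  (\id_D ⊗ \c_(D, E) ⊗ \id_E) ∘ (delta cD ⊗ delta cE).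

(* The coproduct is an argument, and its source a word, so as to cover both
   [delta cD] and [delta_tens cD cE]. *)
Definition convolution (C : strict_smc) (d : seq C) (A : C)
    (aA : algebra A) (dlt : mor d (d ++ d)) (f g : mor d [:: A]) :
    mor d [:: A] :=
  mu aA ∘ (f ⊗ g) ∘ dlt.

Record weak_hopf_algebra (C : strict_smc) (H : C) : Type := WeakHopfAlgebra {
  wha_alg :> algebra H;
  wha_coalg :> coalgebra H;
  antipode : mor [:: H] [:: H];
  wha_a1 : delta wha_coalg ∘ mu wha_alg =
    (mu wha_alg ⊗ mu wha_alg) ∘ delta_tens wha_coalg wha_coalg;
  wha_a2l : eps wha_coalg ∘ mu wha_alg ∘ (mu wha_alg ⊗ \id_H) =
    ((eps wha_coalg ∘ mu wha_alg) ⊗ (eps wha_coalg ∘ mu wha_alg))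
      ∘ (\id_H ⊗ delta wha_coalg ⊗ \id_H);
  wha_a2r : eps wha_coalg ∘ mu wha_alg ∘ (mu wha_alg ⊗ \id_H) =
    ((eps wha_coalg ∘ mu wha_alg) ⊗ (eps wha_coalg ∘ mu wha_alg))
      ∘ (\id_H ⊗ (\c_(H, H) ∘ delta wha_coalg) ⊗ \id_H);
  wha_a3l : (delta wha_coalg ⊗ \id_H) ∘ delta wha_coalg ∘ eta wha_alg =
    (\id_H ⊗ mu wha_alg ⊗ \id_H)
      ∘ ((delta wha_coalg ∘ eta wha_alg) ⊗ (delta wha_coalg ∘ eta wha_alg));
  wha_a3r : (delta wha_coalg ⊗ \id_H) ∘ delta wha_coalg ∘ eta wha_alg =
    (\id_H ⊗ (mu wha_alg ∘ \c_(H, H)) ⊗ \id_H)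
      ∘ ((delta wha_coalg ∘ eta wha_alg) ⊗ (delta wha_coalg ∘ eta wha_alg));
  wha_a4 : convolution wha_alg (delta wha_coalg) (\id_H) antipode =
    ((eps wha_coalg ∘ mu wha_alg) ⊗ \id_H)
      ∘ (\id_H ⊗ \c_(H, H)) ∘ ((delta wha_coalg ∘ eta wha_alg) ⊗ \id_H);
  wha_a5 : convolution wha_alg (delta wha_coalg) antipode (\id_H) =
    (\id_H ⊗ (eps wha_coalg ∘ mu wha_alg))
      ∘ (\c_(H, H) ⊗ \id_H) ∘ (\id_H ⊗ (delta wha_coalg ∘ eta wha_alg));
  wha_a6 : convolution wha_alg (delta wha_coalg)
      (convolution wha_alg (delta wha_coalg) antipode (\id_H)) antipode =
    antipode
}.

Definition is_measuring (C : strict_smc) (H B : C) (cH : coalgebra H)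
    (aB : algebra B) (phi : mor [:: H; B] [:: B]) : Prop :=
  phi ∘ (\id_H ⊗ mu aB) =
  mu aB ∘ (phi ⊗ phi) ∘ (\id_H ⊗ \c_(H, B) ⊗ \id_B)
    ∘ (delta cH ⊗ \id_B ⊗ \id_B).

Definition u1 (C : strict_smc) (H B : C) (aB : algebra B)
    (phi : mor [:: H; B] [:: B]) : mor [:: H] [:: B] :=
  phi ∘ (\id_H ⊗ eta aB).

Definition u2 (C : strict_smc) (H B : C) (aH : algebra H) (aB : algebra B)
    (phi : mor [:: H; B] [:: B]) : mor [:: H; H] [:: B] :=
  phi ∘ (mu aH ⊗ eta aB).

Definition P_ (C : strict_smc) (H B : C) (cH : coalgebra H)
    (phi : mor [:: H; B] [:: B]) : mor [:: H; B] [:: B; H] :=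
  (phi ⊗ \id_H) ∘ (\id_H ⊗ \c_(H, B)) ∘ (delta cH ⊗ \id_B).

Definition F_ (C : strict_smc) (H B : C) (aH : algebra H) (cH : coalgebra H)
    (sigma : mor [:: H; H] [:: B]) : mor [:: H; H] [:: B; H] :=
  (sigma ⊗ mu aH) ∘ delta_tens cH cH.

Definition nabla (C : strict_smc) (H B : C) (cH : coalgebra H)
    (aB : algebra B) (phi : mor [:: H; B] [:: B]) :
    mor [:: B; H] [:: B; H] :=
  (mu aB ⊗ \id_H) ∘ (\id_B ⊗ P_ cH phi) ∘ (\id_B ⊗ \id_H ⊗ eta aB).

Definition twisted_quadruple (C : strict_smc) (H B : C) (aB : algebra B)
    (P : mor [:: H; B] [:: B; H]) (F : mor [:: H; H] [:: B; H]) : Prop :=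
  (mu aB ⊗ \id_H) ∘ (\id_B ⊗ P) ∘ (F ⊗ \id_B) =
  (mu aB ⊗ \id_H) ∘ (\id_B ⊗ F) ∘ (P ⊗ \id_H) ∘ (\id_H ⊗ P).

Definition cocycle_quadruple (C : strict_smc) (H B : C) (aB : algebra B)
    (P : mor [:: H; B] [:: B; H]) (F : mor [:: H; H] [:: B; H]) : Prop :=
  (mu aB ⊗ \id_H) ∘ (\id_B ⊗ F) ∘ (F ⊗ \id_H) =
  (mu aB ⊗ \id_H) ∘ (\id_B ⊗ F) ∘ (P ⊗ \id_H) ∘ (\id_H ⊗ F).

Definition crossed_mul (C : strict_smc) (H B : C) (aH : algebra H)
    (cH : coalgebra H) (aB : algebra B) (phi : mor [:: H; B] [:: B])
    (sigma : mor [:: H; H] [:: B]) : mor [:: B; H; B; H] [:: B; H] :=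
  (mu aB ⊗ \id_H) ∘ (mu aB ⊗ F_ aH cH sigma) ∘ (\id_B ⊗ P_ cH phi ⊗ \id_H).

Definition is_associative (C : strict_smc) (B H : C)
    (m : mor [:: B; H; B; H] [:: B; H]) : Prop :=
  m ∘ (m ⊗ \id_B ⊗ \id_H) = m ∘ (\id_B ⊗ \id_H ⊗ m).

Definition is_normalized (C : strict_smc) (B H : C)
    (m : mor [:: B; H; B; H] [:: B; H]) (nab : mor [:: B; H] [:: B; H]) :
    Prop :=
  nab ∘ m = m /\ m ∘ (nab ⊗ nab) = m.

Definition is_preunit (C : strict_smc) (B H : C)
    (m : mor [:: B; H; B; H] [:: B; H]) (nab : mor [:: B; H] [:: B; H])
    (nu : mor [::] [:: B; H]) : Prop :=
  [/\ m ∘ (\id_B ⊗ \id_H ⊗ nu) = nab,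
      m ∘ (nu ⊗ \id_B ⊗ \id_H) = nab
    & nu = m ∘ (nu ⊗ nu)].

Definition sigma_twisted (C : strict_smc) (H B : C) (aH : algebra H)
    (cH : coalgebra H) (aB : algebra B) (phi : mor [:: H; B] [:: B])
    (sigma : mor [:: H; H] [:: B]) : Prop :=
  mu aB ∘ (\id_B ⊗ sigma) ∘ (P_ cH phi ⊗ \id_H) ∘ (\id_H ⊗ P_ cH phi) =
  mu aB ∘ (\id_B ⊗ phi) ∘ (F_ aH cH sigma ⊗ \id_B).

Definition sigma_cocycle (C : strict_smc) (H B : C) (aH : algebra H)
    (cH : coalgebra H) (aB : algebra B) (phi : mor [:: H; B] [:: B])
    (sigma : mor [:: H; H] [:: B]) : Prop :=
  mu aB ∘ (\id_B ⊗ sigma) ∘ (P_ cH phi ⊗ \id_H) ∘ (\id_H ⊗ F_ aH cH sigma) =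
  mu aB ∘ (\id_B ⊗ sigma) ∘ (F_ aH cH sigma ⊗ \id_H).

Definition sigma_normal (C : strict_smc) (H B : C) (aH : algebra H)
    (aB : algebra B) (phi : mor [:: H; B] [:: B])
    (sigma : mor [:: H; H] [:: B]) : Prop :=
  sigma ∘ (eta aH ⊗ \id_H) = u1 aB phi /\
  sigma ∘ (\id_H ⊗ eta aH) = u1 aB phi.

(* Main.v *)
Require Import Defs.
From mathcomp Require Import all_boot.
From Stdlib Require Import Eqdep.

(** Write [M] for the crossed product on [B ⊗ H], [nab] for its idempotent and
    [G = (mu ⊗ H) ∘ (B ⊗ F) ∘ (P ⊗ H)], so that [M = (mu ⊗ H) ∘ (B ⊗ G)].
    Elements are used below as a shorthand for morphisms: [h1], [h2] are the two
    legs of the coproduct of [h], and [1_1], [1_2] those of the coproduct of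
    the unit of [H].

    The twisted and cocycle conditions on [sigma] are consequences of those on
    [(P, F)]: composing with the counit on the [H]-leg turns [P] into [phi]
    and [F] into [sigma].  The second fact rests on [sigma * u2 = sigma], which
    says that [sigma] is [(B ⊗ eps) ∘ nab ∘ F] ([F_eps]); with the
    multiplicativity of the coproduct of [H] it also gives [nab ∘ F = F]
    ([nabla_F]).

    Associativity and normalization hold in both cases too.  As [phi] is a
    measuring, [P] is compatible with the product of [B] ([P_mul]); hence
    [G(h, b b', k)] is obtained from [P(h, b)] and [G], and the twisted and
    cocycle conditions combine into a formula for [G ∘ (H ⊗ G)] from which
    associativity follows ([quadruple_mul_assoc]).  Normalization follows from
    [nab ∘ F = F] ([nabla_mul], [mul_nabla]).

    So the theorem amounts to: [nu] is a preunit if and only if [sigma] is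
    normal.  Both products with [nu] can be computed: [M(b, h, nu)] is
    [b F(h, 1)] and, because [nab(b, 1) = P(1, b)], [M(nu, b, h)] is
    [b F(1, h)].  Since [nab(b, h) = b P(h, 1)], the preunit condition reads
    [F(h, 1) = P(h, 1) = F(1, h)] ([preunit_iff_normal]).  Applying the counit
    gives the normality of [sigma].

    Conversely, let [sigma] be normal.  The identity
    [F(h, 1) = sigma(h1, 1_1) ⊗ h2 1_2 = sigma(h1, 1) ⊗ h2] is needed, as well
    as its mirror image.  From [sigma * u2 = sigma] and the weak
    comultiplicativity of the unit, [sigma(h, 1_1) ⊗ 1_2] is equal to
    [sigma(h 1_1, 1) ⊗ 1_2] ([balanced_unit]); then
    [h1 1_1 ⊗ h2 1_2 = h1 ⊗ h2] finishes ([cross_unitr]).  The mirror image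
    ([cross_unitl]) is the same statement for the opposite algebra of [H].

    The equalities between string diagrams that these arguments use are of two
    kinds.  Those that hold in every strict monoidal category are proved by
    the tactic [planar], which slices both diagrams into layers with one box
    each and sorts the layers; those that move a box through a crossing are
    instances of the naturality of a braiding between words. *)

Set Implicit Arguments.
Unset Strict Implicit.
Unset Printing Implicit Defensive.
Local Open Scope smc_scope.

(** * Equality of morphisms with different types *)

Section Heterogeneous.
Variable C : strict_smc.

(** Strictness identifies objects by propositional equalities only.  Packing a
    morphism with its source and target makes casts invisible ([hpack_cast])
    and loses nothing, by uniqueness of identity proofs ([hpack_inj]). *)
Definition hpack (A B : C) (f : hom A B) : {p : C * C & hom p.1 p.2} :=
  existT (fun p : C * C => hom p.1 p.2) (A, B) f.

Lemma hpack_inj (A B : C) (f g : hom A B) : hpack f = hpack g -> f = g.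
Proof. exact: (@inj_pair2 _ (fun p : C * C => hom p.1 p.2)). Qed.

Lemma hpack_cast (A A' D D' : C) (eA : A = A') (eD : D = D') (f : hom A D) :
  hpack (cast_hom eA eD f) = hpack f.
Proof. by case: _ / eA; case: _ / eD. Qed.

(** The way to replace a morphism by a packed-equal one whose type differs by
    a variable source and target. *)
Lemma hpack_ind (A B : C) (f : hom A B)
    (Q : forall A' B', hom A' B' -> Prop) :
  Q A B f -> forall A' B' (f' : hom A' B'), hpack f = hpack f' -> Q A' B' f'.
Proof.
move=> Qf A' B' f' e.
exact: (@eq_ind _ (hpack f) (fun p => Q _ _ (projT2 p)) Qf _ e).
Qed.

Lemma hpack_tens (A B D E : C) (f : hom A B) (g : hom D E)
    (A' B' D' E' : C) (f' : hom A' B') (g' : hom D' E') :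
  hpack f = hpack f' -> hpack g = hpack g' ->
  hpack (tensm f g) = hpack (tensm f' g').
Proof.
move=> ef eg.
pose Qf X Y (k : hom X Y) := hpack (tensm f g) = hpack (tensm k g).
pose Qg X Y (k : hom X Y) := hpack (tensm f g) = hpack (tensm f' k).
apply: (hpack_ind (Q := Qg) _ eg); exact: (hpack_ind (Q := Qf) (erefl _) ef).
Qed.

Lemma hpack_comp (A B D : C) (f : hom A B) (g : hom B D)
    (A' B' D' : C) (f' : hom A' B') (g' : hom B' D') :
  hpack f = hpack f' -> hpack g = hpack g' ->
  hpack (compm g f) = hpack (compm g' f').
Proof.
move=> ef eg.
pose Qf X Y (k : hom X Y) := forall Z (g' : hom Y Z), hpack g = hpack g' ->
  hpack (compm g f) = hpack (compm g' k).
suff Qf0 : Qf _ _ f by exact: (hpack_ind Qf0 ef).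
move=> Z h eh.
have eZ : D = Z by case: (congr1 (fun p => (projT1 p).2) eh).
by case: _ / eZ h eh => h /hpack_inj ->.
Qed.

Lemma hpack_tensA (A A' B B' D D' : C)
    (f : hom A A') (g : hom B B') (h : hom D D') :
  hpack (tensm (tensm f g) h) = hpack (tensm f (tensm g h)).
Proof. by rewrite -tensmA hpack_cast. Qed.

Lemma hpack_tens1l (A A' : C) (f : hom A A') :
  hpack (tensm (idm (unit_obj C)) f) = hpack f.
Proof. by rewrite -[in RHS](tensm1l f) hpack_cast. Qed.

Lemma hpack_tens1r (A A' : C) (f : hom A A') :
  hpack (tensm f (idm (unit_obj C))) = hpack f.
Proof. by rewrite -[in RHS](tensm1r f) hpack_cast. Qed.

Lemma hpack_idm (A B : C) : A = B -> hpack (idm A) = hpack (idm B).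
Proof. by move->. Qed.

Definition word_id (w : seq C) : mor w w := idm (tens_word w).

(** [pack] remembers the words, which the objects [tens_word v] do not
    determine; [hpack] suffices once the words are known to agree
    ([pack_ext]). *)
Definition pack (v w : seq C) (f : mor v w) :
    {p : seq C * seq C & mor p.1 p.2} :=
  existT (fun p : seq C * seq C => mor p.1 p.2) (v, w) f.

Lemma pack_inj (v w : seq C) (f g : mor v w) : pack f = pack g -> f = g.
Proof. exact: (@inj_pair2 _ (fun p : seq C * seq C => mor p.1 p.2)). Qed.

Lemma pack_ext (v w v' w' : seq C) (f : mor v w) (g : mor v' w') :
  v = v' -> w = w' -> hpack f = hpack g -> pack f = pack g.
Proof.
move=> ev ew; case: _ / ev g => g; case: _ / ew g => g.
by move/hpack_inj->.
Qed.

Lemma hpack_pack (v w v' w' : seq C) (f : mor v w) (g : mor v' w') :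
  pack f = pack g -> hpack f = hpack g.
Proof.
move=> e; pose h (p : {p : seq C * seq C & mor p.1 p.2}) :=
  hpack (projT2 p : hom (tens_word _) (tens_word _)).
exact: (congr1 h e).
Qed.

Lemma hpack_mor_tens (v v' w w' : seq C) (f : mor v v') (g : mor w w') :
  hpack (f ⊗ g) = hpack (tensm f g).
Proof. exact: hpack_cast. Qed.

Lemma mor_compA (u v w x : seq C) (h : mor w x) (g : mor v w) (f : mor u v) :
  h ∘ (g ∘ f) = (h ∘ g) ∘ f.
Proof. exact: compmA. Qed.

Lemma word_id_compl (v w : seq C) (f : mor v w) : word_id w ∘ f = f.
Proof. exact: compm_idl. Qed.

Lemma word_id_compr (v w : seq C) (f : mor v w) : f ∘ word_id v = f.
Proof. exact: compm_idr. Qed.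

Lemma word_id_tens (v w : seq C) : word_id v ⊗ word_id w = word_id (v ++ w).
Proof.
apply: hpack_inj; rewrite hpack_mor_tens tensm_id.
exact/hpack_idm/esym/tens_word_cat.
Qed.

Lemma mor_interchange (u v w u' v' w' : seq C) (g : mor v w) (f : mor u v)
    (g' : mor v' w') (f' : mor u' v') :
  (g ∘ f) ⊗ (g' ∘ f') = (g ⊗ g') ∘ (f ⊗ f').
Proof.
apply: hpack_inj; rewrite hpack_mor_tens tensm_comp.
by apply: hpack_comp; rewrite hpack_mor_tens.
Qed.

Lemma pack_tens (v v' w w' : seq C) (f : mor v v') (g : mor w w')
   (x x' y y' : seq C) (f' : mor x x') (g' : mor y y') :
  pack f = pack f' -> pack g = pack g' -> pack (f ⊗ g) = pack (f' ⊗ g').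
Proof.
move=> ef eg.
have /= [ev ev'] := congr1 (@projT1 _ _) ef.
have /= [ew ew'] := congr1 (@projT1 _ _) eg.
by subst; rewrite (pack_inj ef) (pack_inj eg).
Qed.

Lemma pack_comp (v w x : seq C) (f : mor v w) (g : mor w x)
   (v' w' x' : seq C) (f' : mor v' w') (g' : mor w' x') :
  pack f = pack f' -> pack g = pack g' -> pack (g ∘ f) = pack (g' ∘ f').
Proof.
move=> ef eg.
have /= [ev ev'] := congr1 (@projT1 _ _) ef.
have /= [_ ew'] := congr1 (@projT1 _ _) eg.
by subst; rewrite (pack_inj ef) (pack_inj eg).
Qed.

Lemma pack_tensA (u u' v v' w w' : seq C) (f : mor u u') (g : mor v v')
    (h : mor w w') :
  pack ((f ⊗ g) ⊗ h) = pack (f ⊗ (g ⊗ h)).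
Proof.
apply: pack_ext; rewrite ?catA // !hpack_mor_tens.
transitivity (hpack (tensm (tensm f g) h)).
  by apply: hpack_tens; rewrite ?hpack_mor_tens.
by rewrite hpack_tensA; apply: hpack_tens; rewrite ?hpack_mor_tens.
Qed.

Lemma pack_tens0l (v w : seq C) (f : mor v w) :
  pack (word_id [::] ⊗ f) = pack f.
Proof. by apply: pack_ext => //; rewrite hpack_mor_tens hpack_tens1l. Qed.

Lemma pack_tens0r (v w : seq C) (f : mor v w) :
  pack (f ⊗ word_id [::]) = pack f.
Proof.
by apply: pack_ext; rewrite ?cats0 // hpack_mor_tens hpack_tens1r.
Qed.

(** Reassociating a concatenation changes the type of a morphism, not its
    packing. *)
Lemma retype (v v' w : seq C) (f : mor v w) :
  v = v' -> exists f' : mor v' w, pack f' = pack f.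
Proof. by move=> ev; case: _ / ev; exists f. Qed.

(** * Slicing planar diagrams into layers *)

Record layer := Layer {
  offset : nat;
  ldom : seq C;
  lcod : seq C;
  lgen : mor ldom lcod }.

(** The first layer of the list is applied first; a layer at offset [n] acts on
    the wires that follow the first [n] ones. *)
Inductive layered : forall v w : seq C, mor v w -> seq layer -> Prop :=
| layered_nil (v : seq C) : layered (word_id v) [::]
| layered_cons (u a b x w : seq C) (f : mor a b) (h : mor (u ++ b ++ x) w) ls :
    layered h ls ->
    layered (h ∘ (word_id u ⊗ (f ⊗ word_id x))) (Layer (size u) f :: ls).

Lemma layered_pack (v w : seq C) (f : mor v w) v' w' (f' : mor v' w') ls :
  pack f = pack f' -> layered f ls -> layered f' ls.
Proof.
move=> e; have /= [ev ew] := congr1 (@projT1 _ _) e.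
by subst; rewrite (pack_inj e).
Qed.

Lemma layered_inv (v w : seq C) (f : mor v w) ls : layered f ls ->
  match ls with
  | [::] => pack f = pack (word_id v)
  | Layer n a b f0 :: ls' =>
    exists u x (h : mor (u ++ b ++ x) w),
      [/\ size u = n, layered h ls'
        & pack f = pack (h ∘ (word_id u ⊗ (f0 ⊗ word_id x)))]
  end.
Proof. by case=> // u a b x w' f0 h ls' dh; exists u, x, h. Qed.

Lemma cat_prefix (T : Type) (p s u r : seq T) :
  size p <= size u -> u ++ r = p ++ s -> exists2 y, u = p ++ y & s = y ++ r.
Proof.
elim: p u => [|x p IHp] [|z u] //=; first by exists [::].
  by exists (z :: u).
by rewrite ltnS => le_pu [-> /(IHp _ le_pu)[y -> ->]]; exists y.
Qed.

Lemma cat_size_inj (T : Type) (u u' a x x' : seq T) :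
  size u = size u' -> u ++ a ++ x = u' ++ a ++ x' -> u = u' /\ x = x'.
Proof.
elim: u u' => [|z u IHu] [|z' u'] //=; last first.
  by case=> su [-> /(IHu _ su)[-> ->]].
by move=> _; elim: a => // z a IHa [/IHa].
Qed.

(** The offset of a layer determines how the word that it acts on splits, so a
    source and a list of layers determine a morphism. *)
Lemma layered_fun (v w : seq C) (f : mor v w) ls : layered f ls ->
  forall w' (f' : mor v w'), layered f' ls -> pack f = pack f'.
Proof.
move=> df; elim: {v w f ls} df => [v|u a b x w f0 h ls dh IH] w' f'.
  by move/layered_inv->.
move=> /layered_inv[u' [x' [h' [su dh' e]]]].
have /= [ev] := congr1 (@projT1 _ _) e.
have [eu ex] := cat_size_inj (esym su) ev.
by subst u' x'; rewrite e; apply: pack_comp => //; apply: IH.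
Qed.

Lemma layered_gen (v w : seq C) (f : mor v w) : layered f [:: Layer 0 f].
Proof.
have := @layered_cons [::] v w [::] _ f (word_id _) [::] (layered_nil _).
apply: layered_pack; rewrite word_id_compl pack_tens0l; exact: pack_tens0r.
Qed.

Lemma layered_comp (u v w : seq C) (f : mor u v) (g : mor v w) lf lg :
  layered f lf -> layered g lg -> layered (g ∘ f) (lf ++ lg).
Proof.
move=> df; elim: {u v f lf} df w g => [u|u' a b x v f0 h lf dh IH] w g dg /=.
  by rewrite word_id_compr.
by rewrite mor_compA; apply: layered_cons; apply: IH.
Qed.

Definition shift n (l : layer) := Layer (n + offset l) (lgen l).

Lemma layered_whiskerl (u v w : seq C) (f : mor v w) ls :
  layered f ls -> layered (word_id u ⊗ f) (map (shift (size u)) ls).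
Proof.
move=> df; elim: {v w f ls} df => [v|u' a b x w f0 h ls dh IH] /=.
  by rewrite word_id_tens; apply: layered_nil.
have [h' e'] := retype (word_id u ⊗ h) (catA u u' (b ++ x)).
have dh' := layered_pack (esym e') IH.
have := layered_cons f0 dh'; rewrite size_cat /shift; apply: layered_pack.
rewrite -[word_id u]word_id_compl mor_interchange.
apply: pack_comp e'.
rewrite -word_id_tens; exact: pack_tensA.
Qed.

Lemma layered_whiskerr (u v w : seq C) (f : mor v w) ls :
  layered f ls -> layered (f ⊗ word_id u) ls.
Proof.
move=> df; elim: {v w f ls} df => [v|u' a b x w f0 h ls dh IH] /=.
  by rewrite word_id_tens; apply: layered_nil.
have [|h' e'] := @retype _ (u' ++ b ++ (x ++ u)) _ (h ⊗ word_id u).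
  by rewrite -!catA.
have dh' := layered_pack (esym e') IH.
apply: layered_pack (layered_cons f0 dh').
rewrite -[word_id u]word_id_compl mor_interchange.
apply: pack_comp e'.
rewrite pack_tensA; apply: pack_tens => //.
rewrite -word_id_tens; exact/esym/pack_tensA.
Qed.

Lemma layered_tens (v v' w w' : seq C) (f : mor v v') (g : mor w w') lf lg :
  layered f lf -> layered g lg ->
  layered (f ⊗ g) (lf ++ map (shift (size v')) lg).
Proof.
move=> df dg.
rewrite -{1}[f]word_id_compl -{1}[g]word_id_compr mor_interchange.
by apply: layered_comp; [exact: layered_whiskerr|exact: layered_whiskerl].
Qed.

(** Sorts by interchange: when the layer [l'] that follows [l] acts strictly to
    the left of [l], it is applied before, and the offset of [l] changes by the
    difference between the numbers of outputs and inputs of [l']. *)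
Fixpoint insert (l : layer) (ls : seq layer) : seq layer :=
  if ls is l' :: ls' then
    if offset l' + size (ldom l') <= offset l then
      l' :: insert
        (Layer (offset l + size (lcod l') - size (ldom l')) (lgen l)) ls'
    else l :: ls
  else [:: l].

Definition normalize := foldr insert [::].

Lemma exchange (u a b y a' b' x : seq C) (f : mor a b) (f' : mor a' b') :
  pack ((word_id u ⊗ (f ⊗ word_id (y ++ b' ++ x))) ∘
        (word_id u ⊗ (word_id a ⊗ (word_id y ⊗ (f' ⊗ word_id x))))) =
  pack ((word_id u ⊗ (word_id b ⊗ (word_id y ⊗ (f' ⊗ word_id x)))) ∘
        (word_id u ⊗ (f ⊗ word_id (y ++ a' ++ x)))).
Proof.
congr pack.
by rewrite -!mor_interchange !word_id_compl !word_id_compr.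
Qed.

Lemma pack_split (u a y a' b' x : seq C) (f' : mor a' b') :
  pack (word_id (u ++ a ++ y) ⊗ (f' ⊗ word_id x)) =
  pack (word_id u ⊗ (word_id a ⊗ (word_id y ⊗ (f' ⊗ word_id x)))).
Proof.
rewrite -!word_id_tens pack_tensA.
by apply: pack_tens => //; rewrite pack_tensA.
Qed.

Lemma layered_insert (v w : seq C) (f : mor v w) l ls :
  layered f (l :: ls) -> layered f (insert l ls).
Proof.
elim: ls l v f => [//|[n' a' b' f'] ls IH] [n a b f0] v f /=.
case: ifP => // le_n /layered_inv [u [x [h [su dh ef]]]].
case/layered_inv: dh => [u' [x' [h' [su' dh' eh]]]].
apply: (layered_pack (esym ef)).
have /= [e] := congr1 (@projT1 _ _) eh.
have [||y] := @cat_prefix _ (u' ++ a') x' u (b ++ x).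
- by rewrite size_cat su su'.
- by rewrite e catA.
rewrite -catA => eu ex; subst u x'.
(* the box [f0] stays in place, but its offset is now counted before [f'] *)
have sy : size (u' ++ b' ++ y) = n + size b' - size a'.
  rewrite -su !size_cat (addnC (size a')) !addnA.
  by rewrite [_ + _ + size b']addnAC addnK addnAC.
have [|k ek] := @retype _ ((u' ++ b' ++ y) ++ b ++ x) _ h'.
  by rewrite -!catA.
have dk := layered_pack (esym ek) dh'.
have dkl := IH _ _ _ (layered_cons f0 dk); rewrite sy in dkl.
have [|k1 ek1] := @retype _ (u' ++ b' ++ (y ++ a ++ x)) _
    (k ∘ (word_id (u' ++ b' ++ y) ⊗ (f0 ⊗ word_id x))).
  by rewrite -!catA.
have := layered_cons f' (layered_pack (esym ek1) dkl); rewrite su'.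
apply: layered_pack.
transitivity (pack
    ((h' ∘ (word_id u' ⊗ (word_id b' ⊗ (word_id y ⊗ (f0 ⊗ word_id x))))) ∘
     (word_id u' ⊗ (f' ⊗ word_id (y ++ a ++ x))))).
  apply: pack_comp => //; rewrite ek1.
  apply: pack_comp ek; exact: pack_split.
rewrite -mor_compA.
transitivity (pack (h' ∘ ((word_id u' ⊗ (f' ⊗ word_id (y ++ b ++ x))) ∘
        (word_id u' ⊗ (word_id a' ⊗ (word_id y ⊗ (f0 ⊗ word_id x))))))).
  by apply: pack_comp => //; rewrite exchange.
rewrite mor_compA; apply: pack_comp (esym eh).
exact/esym/pack_split.
Qed.

Lemma layered_normalize (v w : seq C) (f : mor v w) ls :
  layered f ls -> layered f (normalize ls).
Proof.
move=> df; elim: {v w f ls} df => [v|u a b x w f0 h ls _ IH] /=.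
  exact: layered_nil.
exact/layered_insert/layered_cons.
Qed.

(** Lists of layers with the same normal form denote the same morphism; the
    converse can fail for diagrams that are not connected. *)
Lemma layered_eq (v w : seq C) (f g : mor v w) lf lg :
  layered f lf -> layered g lg -> normalize lf = normalize lg -> f = g.
Proof.
move=> /layered_normalize df /layered_normalize dg e.
by rewrite e in df; apply/pack_inj/(layered_fun df).
Qed.

End Heterogeneous.

(** Computes a list of layers for a morphism by structural recursion, every
    morphism that is not a composite, a tensor product or an identity being a
    box. *)
Ltac layers :=
  lazymatch goal with
  | |- layered (@mor_comp _ _ _ _ ?g ?f) _ =>
      eapply (@layered_comp _ _ _ _ f g); layers
  | |- layered (@mor_tens _ _ _ _ _ ?f ?g) _ =>
      eapply (@layered_tens _ _ _ _ _ f g); layers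
  | |- layered (@mor_id _ ?A) _ => exact (@layered_nil _ [:: A])
  | |- layered (@word_id _ ?w) _ => exact (@layered_nil _ w)
  | |- layered ?f _ => exact (layered_gen f)
  end.

(** Proves equalities that hold by the laws of strict monoidal categories. *)
Ltac planar :=
  lazymatch goal with
  | |- ?f = ?g =>
    refine (@layered_eq _ _ _ f g _ _ _ _ _); [layers | layers | reflexivity]
  end.

(** * Braiding of words *)

Section Braid.
Variable C : strict_smc.

(** The symmetry between two words.  For explicit words the lemmas below express
    it through the symmetries between letters, so that its naturality becomes
    a rule for moving a box through single crossings. *)
Definition braid (v w : seq C) : mor (v ++ w) (w ++ v) :=
  cast_hom (esym (tens_word_cat v w)) (esym (tens_word_cat w v))
    (sym (tens_word v) (tens_word w)).

Lemma hpack_braid (v w : seq C) :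
  hpack (braid v w) = hpack (sym (tens_word v) (tens_word w)).
Proof. exact: hpack_cast. Qed.

Lemma braid_natural (v v' w w' : seq C) (f : mor v v') (g : mor w w') :
  braid v' w' ∘ (f ⊗ g) = (g ⊗ f) ∘ braid v w.
Proof.
apply: hpack_inj.
transitivity (hpack (compm (sym _ _) (tensm f g))).
  by apply: hpack_comp; rewrite ?hpack_braid ?hpack_mor_tens.
rewrite sym_natural.
by apply: hpack_comp; rewrite ?hpack_braid ?hpack_mor_tens.
Qed.

Lemma braidK (v w : seq C) : braid w v ∘ braid v w = word_id (v ++ w).
Proof.
apply: hpack_inj.
transitivity (hpack (compm (sym (tens_word w) (tens_word v)) (sym _ _))).
  by apply: hpack_comp; rewrite ?hpack_braid.
rewrite symK; exact/hpack_idm/esym/tens_word_cat.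
Qed.

Lemma hpack_sym (A A' B B' : C) :
  A = A' -> B = B' -> hpack (sym A B) = hpack (sym A' B').
Proof. by move=> -> ->. Qed.

(** The hexagon.  The two factors are arguments because their types match those
    of the tensor products only up to reassociation of words; for explicit
    words this is convertibility. *)
Lemma braid_catr_pack (u v w : seq C) (k : mor ((v ++ u) ++ w) ((v ++ w) ++ u))
    (k' : mor (u ++ v ++ w) ((v ++ u) ++ w)) :
  pack k = pack (word_id v ⊗ braid u w) ->
  pack k' = pack (braid u v ⊗ word_id w) ->
  braid u (v ++ w) = k ∘ k'.
Proof.
move=> /hpack_pack ek /hpack_pack ek'; apply: hpack_inj.
rewrite hpack_braid (hpack_sym (erefl _) (tens_word_cat v w)) sym_hexagon.
apply: hpack_comp.
  rewrite hpack_cast ek' hpack_mor_tens.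
  by apply: hpack_tens => //; rewrite hpack_braid.
rewrite hpack_cast ek hpack_mor_tens.
by apply: hpack_tens => //; rewrite hpack_braid.
Qed.

End Braid.

Section LetterBraid.
Variable C : strict_smc.
Implicit Types A B D E : C.

Lemma braid11 A B : braid [:: A] [:: B] = \c_(A, B).
Proof. exact/hpack_inj/hpack_braid. Qed.

Lemma symK1 A B : \c_(B, A) ∘ \c_(A, B) = \id_A ⊗ \id_B.
Proof.
rewrite -!braid11 (@braidK _ [:: A] [:: B]).
exact: (esym (@word_id_tens _ [:: A] [:: B])).
Qed.

(** By the hexagon with two empty words this braiding is idempotent; being
    invertible, it is the identity. *)
Lemma braid10 A : braid [:: A] [::] = \id_A.
Proof.
have s2 : braid [:: A] [::] = braid [:: A] [::] ∘ braid [:: A] [::].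
  apply: (@braid_catr_pack _ [:: A] [::] [::]).
    exact/esym/pack_tens0l.
  exact/esym/pack_tens0r.
have := congr1 (mor_comp (braid [::] [:: A])) s2.
by rewrite mor_compA braidK word_id_compl.
Qed.

Lemma braid12 A B D :
  braid [:: A] [:: B; D] = (\id_B ⊗ \c_(A, D)) ∘ (\c_(A, B) ⊗ \id_D).
Proof.
by apply: (@braid_catr_pack _ [:: A] [:: B] [:: D]); rewrite braid11.
Qed.

Lemma braid_invr (v w : seq C) (k : mor (v ++ w) (w ++ v)) :
  k ∘ braid w v = word_id _ -> braid v w = k.
Proof.
by move=> e; rewrite -[LHS]word_id_compl -e -mor_compA braidK word_id_compr.
Qed.

Lemma braid01 A : braid [::] [:: A] = \id_A.
Proof. by apply: braid_invr; rewrite braid10; apply: word_id_compl. Qed.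

Lemma braid21 A B D :
  braid [:: A; B] [:: D] = (\c_(A, D) ⊗ \id_B) ∘ (\id_A ⊗ \c_(B, D)).
Proof.
apply: (@braid_invr [:: A; B] [:: D]); rewrite braid12.
transitivity ((\c_(A, D) ⊗ \id_B) ∘ (\id_A ⊗ (\c_(B, D) ∘ \c_(D, B))) ∘
              (\c_(D, A) ⊗ \id_B)); first by planar.
rewrite symK1.
transitivity ((\c_(A, D) ∘ \c_(D, A)) ⊗ \id_B); first by planar.
rewrite symK1; planar.
Qed.

Lemma braid22 A B D E :
  braid [:: A; B] [:: D; E] = (\id_D ⊗ (braid [:: A; B] [:: E]))
    ∘ (braid [:: A; B] [:: D] ⊗ \id_E).
Proof. exact: (@braid_catr_pack _ [:: A; B] [:: D] [:: E]). Qed.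

Lemma sym_natr A B (v : seq C) (f : mor v [:: B]) :
  \c_(A, B) ∘ (\id_A ⊗ f) = (f ⊗ \id_A) ∘ braid [:: A] v.
Proof. by rewrite -braid11; exact: (braid_natural (\id_A) f). Qed.

Lemma sym_natl A B (v : seq C) (f : mor v [:: B]) :
  \c_(B, A) ∘ (f ⊗ \id_A) = (\id_A ⊗ f) ∘ braid v [:: A].
Proof. by rewrite -braid11; exact: (braid_natural f (\id_A)). Qed.

Lemma natr_sym A B (w : seq C) (f : mor [:: B] w) :
  (f ⊗ \id_A) ∘ \c_(A, B) = braid [:: A] w ∘ (\id_A ⊗ f).
Proof. by rewrite -braid11; exact: (esym (braid_natural (\id_A) f)). Qed.

Lemma natl_sym A B (w : seq C) (f : mor [:: B] w) :
  (\id_A ⊗ f) ∘ \c_(B, A) = braid w [:: A] ∘ (f ⊗ \id_A).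
Proof. by rewrite -braid11; exact: (esym (braid_natural f (\id_A))). Qed.

End LetterBraid.

(** * Coproduct of the unit, and morphisms balanced over it *)

Section DeltaTens.
Variables (C : strict_smc) (H : C) (cH : coalgebra H).
Local Notation I := (\id_H).
Local Notation c := (\c_(H, H)).
Local Notation d := (delta cH).
Local Notation dd := (delta_tens cH cH).

(** Once every coproduct has been moved above the crossings, the two sides have
    the same crossings, and differ by coassociativity of [d]. *)
Lemma delta_tensA : (dd ⊗ I ⊗ I) ∘ dd = (I ⊗ I ⊗ dd) ∘ dd.
Proof.
transitivity ((I ⊗ c ⊗ I ⊗ I ⊗ I) ∘ (I ⊗ I ⊗ ((d ⊗ I) ∘ c) ⊗ I) ∘
  (((d ⊗ I) ∘ d) ⊗ d)).
  rewrite /delta_tens; planar.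
rewrite natr_sym deltaA braid12.
transitivity ((I ⊗ c ⊗ c ⊗ I) ∘ (I ⊗ I ⊗ c ⊗ I ⊗ I) ∘
   (((I ⊗ d) ∘ d) ⊗ ((d ⊗ I) ∘ d))); first by planar.
rewrite deltaA.
transitivity ((I ⊗ I ⊗ I ⊗ c ⊗ I) ∘ (I ⊗ ((I ⊗ d) ∘ c) ⊗ I ⊗ I) ∘
  (d ⊗ ((I ⊗ d) ∘ d))).
  rewrite natl_sym braid21; planar.
rewrite /delta_tens; planar.
Qed.

(** The middle crossing of [braid [:: H; H] [:: H; H]] cancels the one of
    [dd]. *)
Lemma delta_tens_sym : (c ⊗ c) ∘ dd = dd ∘ c.
Proof.
transitivity ((I ⊗ c ⊗ I) ∘ (d ⊗ d) ∘ c); last by rewrite /delta_tens; planar.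
have nat := braid_natural d d; rewrite braid11 braid22 !braid21 in nat.
rewrite -nat.
transitivity ((I ⊗ (c ∘ c) ⊗ I) ∘ (c ⊗ c) ∘ dd).
  rewrite symK1; planar.
rewrite /delta_tens; planar.
Qed.

End DeltaTens.

Section RightUnit.
Variables (C : strict_smc) (H : C) (aH : algebra H) (cH : coalgebra H).
Local Notation I := (\id_H).
Local Notation c := (\c_(H, H)).
Local Notation d := (delta cH).
Local Notation m := (mu aH).
Local Notation e := (eta aH).
Local Notation dd := (delta_tens cH cH).

Hypothesis a1 : d ∘ m = (m ⊗ m) ∘ dd.
Hypothesis a3l : (d ⊗ I) ∘ d ∘ e = (I ⊗ m ⊗ I) ∘ ((d ∘ e) ⊗ (d ∘ e)).
Hypothesis a3r : (d ⊗ I) ∘ d ∘ e = (I ⊗ (m ∘ c) ⊗ I) ∘ ((d ∘ e) ⊗ (d ∘ e)).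

(** By [a1] and [a3l] the left side is [h1 1_1 ⊗ h2 1_2 1'_1 ⊗ 1'_2], where [1']
    is a second copy of the unit, and [h1 1_1 ⊗ h2 1_2] is the coproduct of
    [h 1]. *)
Lemma delta_mul_unit :
  ((d ∘ m) ⊗ I) ∘ (I ⊗ (d ∘ e)) = (I ⊗ m ⊗ I) ∘ (d ⊗ (d ∘ e)).
Proof.
rewrite a1.
transitivity ((m ⊗ m ⊗ I) ∘ (I ⊗ c ⊗ I ⊗ I) ∘ (d ⊗ ((d ⊗ I) ∘ d ∘ e))).
  rewrite /delta_tens; planar.
rewrite a3l.
transitivity ((m ⊗ (m ∘ (I ⊗ m)) ⊗ I) ∘ (I ⊗ c ⊗ I ⊗ I ⊗ I) ∘
   (d ⊗ (d ∘ e) ⊗ (d ∘ e))); first by planar.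
rewrite -muA.
transitivity ((I ⊗ m ⊗ I) ∘ ((((m ⊗ m) ∘ dd) ∘ (I ⊗ e)) ⊗ (d ∘ e))).
  rewrite /delta_tens; planar.
by rewrite -a1 -mor_compA mu_etar; planar.
Qed.

(** A wire may pass the coproduct of the unit, which has no input, on either
    side: both legs can be drawn on its right or on its left. *)
Lemma sym_delta_unit (X : C) :
  (\c_(X, H) ⊗ I) ∘ (\id_X ⊗ (d ∘ e)) = (I ⊗ \c_(H, X)) ∘ ((d ∘ e) ⊗ \id_X).
Proof.
have -> : \id_X ⊗ (d ∘ e) = braid [:: H; H] [:: X] ∘ ((d ∘ e) ⊗ \id_X).
  rewrite (braid_natural (d ∘ e) (\id_X)) braid01; planar.
rewrite braid21.
transitivity (((\c_(X, H) ∘ \c_(H, X)) ⊗ I) ∘ (I ⊗ \c_(H, X)) ∘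
   ((d ∘ e) ⊗ \id_X)); first by planar.
rewrite symK1; planar.
Qed.

Variables (B : C) (aB : algebra B) (u : mor [:: H] [:: B]).
Variable (s : mor [:: H; H] [:: B]).
Hypothesis su : convolution aB dd s (u ∘ m) = s.
Local Notation mB := (mu aB).

(** By [su] the two sides, [s(h, 1_1) ⊗ 1_2] and [s(h 1_1, 1) ⊗ 1_2], are both
    [s(h1, 1'_1) u(h2 1_1 1'_2) ⊗ 1_2], where [1'] is a second copy of the
    unit: the first one by [a3r], the second one by [delta_mul_unit]. *)
Lemma balanced_unit :
  (s ⊗ I) ∘ (I ⊗ (d ∘ e)) = ((s ∘ (m ⊗ e)) ⊗ I) ∘ (I ⊗ (d ∘ e)).
Proof.
rewrite -su /convolution.
transitivity (((mB ∘ (s ⊗ (u ∘ m))) ⊗ I) ∘ (I ⊗ c ⊗ I ⊗ I) ∘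
   (d ⊗ ((d ⊗ I) ∘ d ∘ e))).
  rewrite /delta_tens; planar.
rewrite a3r.
transitivity (((mB ∘ (s ⊗ (u ∘ m ∘ (I ⊗ m)))) ⊗ I) ∘ (I ⊗ c ⊗ I ⊗ I ⊗ I) ∘
  (I ⊗ I ⊗ ((I ⊗ c) ∘ ((d ∘ e) ⊗ I)) ⊗ I) ∘ (d ⊗ (d ∘ e))).
  planar.
rewrite -sym_delta_unit -muA.
transitivity (((mB ∘ (s ⊗ (u ∘ m))) ⊗ I) ∘
  (I ⊗ ((I ⊗ m) ∘ braid [:: H; H] [:: H]) ⊗ I ⊗ I) ∘
  (I ⊗ I ⊗ I ⊗ (d ∘ e) ⊗ I) ∘ (d ⊗ (d ∘ e))).
  rewrite braid21; planar.
rewrite -sym_natl.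
transitivity (((mB ∘ (s ⊗ (u ∘ m))) ⊗ I) ∘ (I ⊗ c ⊗ I ⊗ I) ∘
  (I ⊗ I ⊗ (d ∘ e) ⊗ I) ∘ ((I ⊗ m ⊗ I) ∘ (d ⊗ (d ∘ e)))).
  planar.
rewrite -delta_mul_unit /delta_tens; planar.
Qed.

(** The left side is [s(h1, 1_1) ⊗ h2 1_2]; balance moves [1_1] into the first
    argument of [s], and there [h1 1_1 ⊗ h2 1_2 = h1 ⊗ h2] absorbs it. *)
Lemma cross_unitr :
  (s ⊗ m) ∘ dd ∘ (I ⊗ e) = ((s ∘ (I ⊗ e)) ⊗ I) ∘ d.
Proof.
transitivity ((s ⊗ m) ∘ (I ⊗ ((c ⊗ I) ∘ (I ⊗ (d ∘ e)))) ∘ d).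
  rewrite /delta_tens; planar.
rewrite sym_delta_unit.
transitivity ((\id_B ⊗ (m ∘ c)) ∘ (((s ⊗ I) ∘ (I ⊗ (d ∘ e))) ⊗ I) ∘ d).
  planar.
rewrite balanced_unit.
transitivity (((s ∘ (I ⊗ e)) ⊗ I) ∘ (m ⊗ m) ∘
  (I ⊗ ((I ⊗ c) ∘ ((d ∘ e) ⊗ I))) ∘ d).
  planar.
rewrite -sym_delta_unit.
transitivity (((s ∘ (I ⊗ e)) ⊗ I) ∘ ((m ⊗ m) ∘ dd) ∘ (I ⊗ e)).
  rewrite /delta_tens; planar.
rewrite -a1 -(mor_compA d) mu_etar; planar.
Qed.
End RightUnit.

Section Opposite.
Variables (C : strict_smc) (H : C) (aH : algebra H).
Local Notation I := (\id_H).
Local Notation c := (\c_(H, H)).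
Local Notation m := (mu aH).
Local Notation e := (eta aH).

Lemma op_etal : (m ∘ c) ∘ (e ⊗ I) = I.
Proof. by rewrite -mor_compA sym_natl braid01 -[RHS](mu_etar aH); planar. Qed.

Lemma op_etar : (m ∘ c) ∘ (I ⊗ e) = I.
Proof. by rewrite -mor_compA sym_natr braid10 -[RHS](mu_etal aH); planar. Qed.

Lemma op_mulA : (m ∘ c) ∘ ((m ∘ c) ⊗ I) = (m ∘ c) ∘ (I ⊗ (m ∘ c)).
Proof.
transitivity (m ∘ (c ∘ (m ⊗ I)) ∘ (c ⊗ I)); first by planar.
transitivity (m ∘ (c ∘ (I ⊗ m)) ∘ (I ⊗ c)); last by planar.
rewrite sym_natl sym_natr braid21 braid12.
transitivity ((m ∘ (I ⊗ m)) ∘ (c ⊗ I) ∘ (I ⊗ c) ∘ (c ⊗ I)); first by planar.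
rewrite -muA.
transitivity (m ∘ (m ⊗ I) ∘ (braid [:: H; H] [:: H] ∘ (c ⊗ I))).
  rewrite braid21; planar.
rewrite (braid_natural c I) braid21; planar.
Qed.

Definition op_algebra : algebra H := Algebra op_etal op_etar op_mulA.
End Opposite.

Section LeftUnit.
Variables (C : strict_smc) (H : C) (aH : algebra H) (cH : coalgebra H).
Local Notation I := (\id_H).
Local Notation c := (\c_(H, H)).
Local Notation d := (delta cH).
Local Notation m := (mu aH).
Local Notation e := (eta aH).
Local Notation dd := (delta_tens cH cH).

Hypothesis a1 : d ∘ m = (m ⊗ m) ∘ dd.
Hypothesis a3l : (d ⊗ I) ∘ d ∘ e = (I ⊗ m ⊗ I) ∘ ((d ∘ e) ⊗ (d ∘ e)).
Hypothesis a3r : (d ⊗ I) ∘ d ∘ e = (I ⊗ (m ∘ c) ⊗ I) ∘ ((d ∘ e) ⊗ (d ∘ e)).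
Variables (B : C) (aB : algebra B) (u : mor [:: H] [:: B]).
Variable (s : mor [:: H; H] [:: B]).
Hypothesis su : convolution aB dd s (u ∘ m) = s.

(** [cross_unitr] for the opposite algebra and [s ∘ c].  Passing to the opposite
    algebra exchanges [a3l] and [a3r]. *)
Lemma cross_unitl :
  (s ⊗ m) ∘ dd ∘ (e ⊗ I) = ((s ∘ (e ⊗ I)) ⊗ I) ∘ d.
Proof.
have a1op : d ∘ mu (op_algebra aH) =
    (mu (op_algebra aH) ⊗ mu (op_algebra aH)) ∘ dd.
  rewrite /= mor_compA a1 -mor_compA -delta_tens_sym; planar.
have mcc : (m ∘ c) ∘ c = m.
  rewrite -mor_compA symK1 -[RHS]word_id_compr; planar.
have := @cross_unitr _ _ (op_algebra aH) cH a1op a3r _ _ aB u (s ∘ c) _.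
rewrite /= mcc => /(_ a3l) main.
have sc : c ∘ (I ⊗ e) = e ⊗ I by rewrite sym_natr braid10; planar.
have := main _; rewrite -[(s ∘ c) ∘ _]mor_compA sc => <-.
  rewrite -sc.
  transitivity ((s ⊗ m) ∘ (dd ∘ c) ∘ (I ⊗ e)); first by planar.
  rewrite -delta_tens_sym; planar.
rewrite -[RHS](congr1 (fun k => k ∘ c) su) /convolution.
transitivity (mu aB ∘ (s ⊗ (u ∘ m)) ∘ ((c ⊗ c) ∘ dd)); first by planar.
rewrite delta_tens_sym; planar.
Qed.
End LeftUnit.

(** * Products defined by a quadruple [(B, H, P, F)] *)

Section Quadruple.
Variables (C : strict_smc) (H B : C) (aB : algebra B).
Variables (P : mor [:: H; B] [:: B; H]) (F : mor [:: H; H] [:: B; H]).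
Local Notation I := (\id_H).
Local Notation J := (\id_B).
Local Notation m := (mu aB).
Local Notation e := (eta aB).

Definition quadruple_nabla : mor [:: B; H] [:: B; H] :=
  (m ⊗ I) ∘ (J ⊗ P) ∘ (J ⊗ I ⊗ e).
Definition quadruple_mul : mor [:: B; H; B; H] [:: B; H] :=
  (m ⊗ I) ∘ (m ⊗ F) ∘ (J ⊗ P ⊗ I).
(** The product of [1 ⊗ h] and [b ⊗ k]; it determines the whole product, which
    is left [B]-linear ([quadruple_mulE]). *)
Definition twisted_mul : mor [:: H; B; H] [:: B; H] :=
  (m ⊗ I) ∘ (J ⊗ F) ∘ (P ⊗ I).

Local Notation nab := quadruple_nabla.
Local Notation M := quadruple_mul.
Local Notation G := twisted_mul.

Lemma quadruple_mulE : M = (m ⊗ I) ∘ (J ⊗ G).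
Proof.
transitivity (((m ∘ (m ⊗ J)) ⊗ I) ∘ (J ⊗ J ⊗ F) ∘ (J ⊗ P ⊗ I)).
  rewrite /quadruple_mul; planar.
rewrite muA /twisted_mul; planar.
Qed.

Lemma quadruple_nablaE : nab = (m ⊗ I) ∘ (J ⊗ (P ∘ (I ⊗ e))).
Proof. rewrite /quadruple_nabla; planar. Qed.

Lemma nabla_mull : nab ∘ (m ⊗ I) = (m ⊗ I) ∘ (J ⊗ nab).
Proof.
rewrite quadruple_nablaE.
transitivity (((m ∘ (m ⊗ J)) ⊗ I) ∘ (J ⊗ J ⊗ (P ∘ (I ⊗ e)))); first by planar.
rewrite muA; planar.
Qed.

Lemma mul_mull : M ∘ (m ⊗ I ⊗ J ⊗ I) = (m ⊗ I) ∘ (J ⊗ M).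
Proof.
rewrite quadruple_mulE.
transitivity (((m ∘ (m ⊗ J)) ⊗ I) ∘ (J ⊗ J ⊗ G)); first by planar.
rewrite muA; planar.
Qed.

Lemma nabla_unitl : nab ∘ (e ⊗ I) = P ∘ (I ⊗ e).
Proof.
transitivity (((m ∘ (e ⊗ J)) ⊗ I) ∘ P ∘ (I ⊗ e)).
  rewrite /quadruple_nabla; planar.
rewrite mu_etal; planar.
Qed.

Lemma mul_unitl : M ∘ (e ⊗ I ⊗ J ⊗ I) = G.
Proof.
rewrite quadruple_mulE.
transitivity (((m ∘ (e ⊗ J)) ⊗ I) ∘ G); first by planar.
rewrite mu_etal; planar.
Qed.

Hypothesis P_mul : P ∘ (I ⊗ m) = (m ⊗ I) ∘ (J ⊗ P) ∘ (P ⊗ J).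
Hypothesis F_nabla : nab ∘ F = F.
Hypothesis F_twisted : twisted_quadruple aB P F.
Hypothesis F_cocycle : cocycle_quadruple aB P F.

Lemma twisted_mul_mull :
  G ∘ (I ⊗ m ⊗ I) = (m ⊗ I) ∘ (J ⊗ G) ∘ (P ⊗ J ⊗ I).
Proof.
transitivity ((m ⊗ I) ∘ (J ⊗ F) ∘ ((P ∘ (I ⊗ m)) ⊗ I)).
  rewrite /twisted_mul; planar.
rewrite P_mul.
transitivity (((m ∘ (m ⊗ J)) ⊗ I) ∘ (J ⊗ J ⊗ F) ∘ (J ⊗ P ⊗ I) ∘ (P ⊗ J ⊗ I)).
  planar.
rewrite muA /twisted_mul; planar.
Qed.

Lemma nabla_idem : nab ∘ nab = nab.
Proof.
rewrite {2}quadruple_nablaE.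
transitivity ((nab ∘ (m ⊗ I)) ∘ (J ⊗ (P ∘ (I ⊗ e)))); first by planar.
rewrite nabla_mull {1}/quadruple_nabla.
transitivity ((m ⊗ I) ∘ (J ⊗ ((m ⊗ I) ∘ (J ⊗ P) ∘ (P ⊗ J))) ∘ (J ⊗ I ⊗ e ⊗ e)).
  planar.
rewrite -P_mul.
transitivity ((m ⊗ I) ∘ (J ⊗ P) ∘ (J ⊗ I ⊗ (m ∘ (e ⊗ J) ∘ e))); first by planar.
rewrite [m ∘ _]mor_compA mu_etal /quadruple_nabla; planar.
Qed.

(** An arbitrary [r] in place of the counit: the twisted and cocycle conditions
    survive any map from the [H]-leg to the unit object. *)
Lemma twisted_counit (r : mor [:: H] [::]) :
  m ∘ (J ⊗ ((J ⊗ r) ∘ F)) ∘ (P ⊗ I) ∘ (I ⊗ P) =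
  m ∘ (J ⊗ ((J ⊗ r) ∘ P)) ∘ (F ⊗ J).
Proof.
transitivity ((J ⊗ r) ∘ (m ⊗ I) ∘ (J ⊗ F) ∘ (P ⊗ I) ∘ (I ⊗ P)); first by planar.
rewrite -F_twisted; planar.
Qed.

Lemma cocycle_counit (r : mor [:: H] [::]) :
  m ∘ (J ⊗ ((J ⊗ r) ∘ F)) ∘ (P ⊗ I) ∘ (I ⊗ F) =
  m ∘ (J ⊗ ((J ⊗ r) ∘ F)) ∘ (F ⊗ I).
Proof.
transitivity ((J ⊗ r) ∘ (m ⊗ I) ∘ (J ⊗ F) ∘ (P ⊗ I) ∘ (I ⊗ F)); first by planar.
rewrite -F_cocycle; planar.
Qed.

Lemma twisted_mul_P : G ∘ (I ⊗ P) = (m ⊗ I) ∘ (J ⊗ P) ∘ (F ⊗ J).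
Proof. rewrite F_twisted /twisted_mul; planar. Qed.

Lemma twisted_mul_F : G ∘ (I ⊗ F) = (m ⊗ I) ∘ (J ⊗ F) ∘ (F ⊗ I).
Proof. rewrite F_cocycle /twisted_mul; planar. Qed.

(** [G(h, G(k, b, l))] is [b' F(h', F(k', l))], where [b' ⊗ h' ⊗ k'] comes from
    moving [b] across [k] and [h].  The cocycle condition replaces the two
    nested [F] by [F(F(h', k'), l)], and the twisted condition undoes the
    move of [b]. *)
Lemma twisted_mul_twisted_mul :
  G ∘ (I ⊗ G) = (m ⊗ I) ∘ (J ⊗ G) ∘ (F ⊗ J ⊗ I).
Proof.
transitivity ((G ∘ (I ⊗ m ⊗ I)) ∘ (I ⊗ J ⊗ F) ∘ (I ⊗ P ⊗ I)).
  rewrite {2}/twisted_mul; planar.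
rewrite twisted_mul_mull.
transitivity ((m ⊗ I) ∘ (J ⊗ (G ∘ (I ⊗ F))) ∘ (P ⊗ I ⊗ I) ∘ (I ⊗ P ⊗ I)).
  planar.
rewrite twisted_mul_F.
transitivity ((((m ∘ (J ⊗ m)) ⊗ I) ∘ (J ⊗ J ⊗ F)) ∘ (J ⊗ F ⊗ I) ∘
   (P ⊗ I ⊗ I) ∘ (I ⊗ P ⊗ I)); first by planar.
rewrite -muA.
transitivity ((m ⊗ I) ∘ (J ⊗ F) ∘ ((G ∘ (I ⊗ P)) ⊗ I)).
  rewrite /twisted_mul; planar.
rewrite twisted_mul_P.
transitivity (((m ∘ (m ⊗ J)) ⊗ I) ∘ (J ⊗ J ⊗ F) ∘ (J ⊗ P ⊗ I) ∘ (F ⊗ J ⊗ I)).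
  planar.
rewrite muA /twisted_mul; planar.
Qed.

(** By [B]-linearity it is enough to compute the product of [1 ⊗ h] with
    [(b ⊗ k) (b' ⊗ l)], which [twisted_mul_mull] reduces to
    [twisted_mul_twisted_mul]. *)
Lemma quadruple_mul_assoc : M ∘ (M ⊗ J ⊗ I) = M ∘ (J ⊗ I ⊗ M).
Proof.
transitivity ((m ⊗ I) ∘ (J ⊗ (G ∘ (I ⊗ m ⊗ I))) ∘ (J ⊗ I ⊗ J ⊗ G)); last first.
  rewrite quadruple_mulE; planar.
rewrite twisted_mul_mull.
transitivity ((m ⊗ I) ∘ (J ⊗ m ⊗ I) ∘ (J ⊗ J ⊗ (G ∘ (I ⊗ G))) ∘
   (J ⊗ P ⊗ I ⊗ J ⊗ I)); last by planar.
rewrite twisted_mul_twisted_mul {2}/quadruple_mul.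
transitivity (((M ∘ (m ⊗ I ⊗ J ⊗ I)) ∘ (m ⊗ F ⊗ J ⊗ I)) ∘ (J ⊗ P ⊗ I ⊗ J ⊗ I)).
  planar.
rewrite mul_mull quadruple_mulE.
transitivity (((m ∘ (m ⊗ J)) ⊗ I) ∘
   (J ⊗ J ⊗ ((m ⊗ I) ∘ (J ⊗ G) ∘ (F ⊗ J ⊗ I))) ∘ (J ⊗ P ⊗ I ⊗ J ⊗ I)).
  planar.
rewrite muA; planar.
Qed.

(** [G(h, nab(b, k))] is obtained from [b' ⊗ h' = P(h, b)] and [G(h', P(k, 1))],
    which by the twisted condition is [nab(F(h', k)) = F(h', k)]. *)
Lemma twisted_mul_nablar : G ∘ (I ⊗ nab) = G.
Proof.
rewrite {1}quadruple_nablaE.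
transitivity ((G ∘ (I ⊗ m ⊗ I)) ∘ (I ⊗ J ⊗ (P ∘ (I ⊗ e)))); first by planar.
rewrite twisted_mul_mull.
transitivity ((m ⊗ I) ∘ (J ⊗ ((G ∘ (I ⊗ P)) ∘ (I ⊗ I ⊗ e))) ∘ (P ⊗ I)).
  planar.
rewrite twisted_mul_P.
transitivity ((m ⊗ I) ∘ (J ⊗ (nab ∘ F)) ∘ (P ⊗ I)).
  rewrite /quadruple_nabla; planar.
by rewrite F_nabla.
Qed.

Lemma nabla_twisted_mul : nab ∘ G = G.
Proof.
rewrite /twisted_mul mor_compA nabla_mull.
transitivity ((m ⊗ I) ∘ (J ⊗ (nab ∘ F)) ∘ (P ⊗ I)); first by planar.
by rewrite F_nabla.
Qed.

Lemma nabla_mul : nab ∘ M = M.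
Proof.
rewrite quadruple_mulE mor_compA nabla_mull.
transitivity ((m ⊗ I) ∘ (J ⊗ (nab ∘ G))); first by planar.
by rewrite nabla_twisted_mul.
Qed.

Lemma mul_nablal : M ∘ (nab ⊗ J ⊗ I) = M.
Proof.
rewrite {1}quadruple_nablaE.
transitivity ((M ∘ (m ⊗ I ⊗ J ⊗ I)) ∘ (J ⊗ (P ∘ (I ⊗ e)) ⊗ J ⊗ I)).
  planar.
rewrite mul_mull {1}quadruple_mulE.
transitivity ((m ⊗ I) ∘ (J ⊗ ((m ⊗ I) ∘ (J ⊗ G) ∘ (P ⊗ J ⊗ I))) ∘
  (J ⊗ I ⊗ e ⊗ J ⊗ I)); first by planar.
rewrite -twisted_mul_mull.
transitivity ((m ⊗ I) ∘ (J ⊗ G) ∘ (J ⊗ I ⊗ (m ∘ (e ⊗ J)) ⊗ I)).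
  planar.
rewrite mu_etal quadruple_mulE; planar.
Qed.

Lemma mul_nablar : M ∘ (J ⊗ I ⊗ nab) = M.
Proof.
rewrite quadruple_mulE.
transitivity ((m ⊗ I) ∘ (J ⊗ (G ∘ (I ⊗ nab)))); first by planar.
by rewrite twisted_mul_nablar.
Qed.

Lemma mul_nabla : M ∘ (nab ⊗ nab) = M.
Proof.
transitivity ((M ∘ (nab ⊗ J ⊗ I)) ∘ (J ⊗ I ⊗ nab)); first by planar.
by rewrite mul_nablal mul_nablar.
Qed.

(** [P(h, 1)] is not [1 ⊗ h] in general, but [F] absorbs the difference.  Write
    [F(h, k)] as [G(h, P(k, 1))]; then [G(h, 1, k)] contains
    [P(h, 1)] followed by [G], which is [G(h, 1 b, k') = G(h, b, k')] for
    [b ⊗ k' = P(k, 1)]. *)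
Lemma twisted_mul_unit : G ∘ (I ⊗ e ⊗ I) = F.
Proof.
have GPe : G ∘ (I ⊗ (P ∘ (I ⊗ e))) = F.
  transitivity ((G ∘ (I ⊗ P)) ∘ (I ⊗ I ⊗ e)); first by planar.
  rewrite twisted_mul_P -[RHS]F_nabla /quadruple_nabla; planar.
transitivity ((m ⊗ I) ∘ (J ⊗ F) ∘ ((P ∘ (I ⊗ e)) ⊗ I)).
  rewrite /twisted_mul; planar.
rewrite -{1}GPe.
transitivity (((m ⊗ I) ∘ (J ⊗ G) ∘ (P ⊗ J ⊗ I)) ∘ (I ⊗ e ⊗ (P ∘ (I ⊗ e)))).
  planar.
rewrite -twisted_mul_mull.
transitivity (G ∘ (I ⊗ (m ∘ (e ⊗ J)) ⊗ I) ∘ (I ⊗ (P ∘ (I ⊗ e)))).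
  planar.
rewrite mu_etal -[RHS]GPe; planar.
Qed.

Variable (o : mor [::] [:: H]).
Hypothesis P_unit : nab ∘ (J ⊗ o) = P ∘ (o ⊗ J).
Local Notation nu := (nab ∘ (e ⊗ o)).

Lemma twisted_mul_nu : G ∘ (I ⊗ nu) = F ∘ (I ⊗ o).
Proof.
transitivity ((G ∘ (I ⊗ nab)) ∘ (I ⊗ e ⊗ o)); first by planar.
rewrite twisted_mul_nablar -[in RHS]twisted_mul_unit; planar.
Qed.

Lemma mul_nur : M ∘ (J ⊗ I ⊗ nu) = (m ⊗ I) ∘ (J ⊗ (F ∘ (I ⊗ o))).
Proof. rewrite -twisted_mul_nu quadruple_mulE; planar. Qed.

(** In [M(nu, b, h)] the element [b] stands on the right of the unit of [H];
    [P_unit] brings it to the left, leaving [G(1, 1, h) = F(1, h)]. *)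
Lemma mul_nul : M ∘ (nu ⊗ J ⊗ I) = (m ⊗ I) ∘ (J ⊗ (F ∘ (o ⊗ I))).
Proof.
transitivity ((M ∘ (nab ⊗ J ⊗ I)) ∘ (e ⊗ I ⊗ J ⊗ I) ∘ (o ⊗ J ⊗ I)).
  planar.
rewrite mul_nablal mor_compA mul_unitl.
transitivity ((m ⊗ I) ∘ (J ⊗ F) ∘ ((P ∘ (o ⊗ J)) ⊗ I)).
  rewrite /twisted_mul; planar.
rewrite -P_unit quadruple_nablaE.
transitivity (((m ∘ (m ⊗ J)) ⊗ I) ∘ (J ⊗ J ⊗ F) ∘
  (J ⊗ (P ∘ (I ⊗ e)) ⊗ I) ∘ (J ⊗ o ⊗ I)).
  planar.
rewrite muA.
transitivity ((m ⊗ I) ∘ (J ⊗ (G ∘ (I ⊗ e ⊗ I) ∘ (o ⊗ I)))).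
  rewrite /twisted_mul; planar.
by rewrite mor_compA twisted_mul_unit.
Qed.

(** Both unit conditions are left [B]-linear, hence equivalent to their values
    at the unit of [B]; the third condition follows from the first, because
    [M(nu, nu) = nab nu]. *)
Lemma preunit_iff_normal :
  [/\ M ∘ (J ⊗ I ⊗ nu) = nab, M ∘ (nu ⊗ J ⊗ I) = nab & nu = M ∘ (nu ⊗ nu)]
  <-> F ∘ (I ⊗ o) = P ∘ (I ⊗ e) /\ F ∘ (o ⊗ I) = P ∘ (I ⊗ e).
Proof.
have unitlK (k : mor [:: H] [:: B; H]) :
    (m ⊗ I) ∘ (J ⊗ k) ∘ (e ⊗ I) = k.
  transitivity (((m ∘ (e ⊗ J)) ⊗ I) ∘ k); first by planar.
  rewrite mu_etal; planar.
split=> [[rnu lnu _]|[FIo FoI]].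
  rewrite mul_nur in rnu; rewrite mul_nul in lnu.
  split; first by rewrite -nabla_unitl -rnu -mor_compA unitlK.
  by rewrite -nabla_unitl -lnu -mor_compA unitlK.
have rnu : M ∘ (J ⊗ I ⊗ nu) = nab.
  by rewrite mul_nur FIo quadruple_nablaE.
split=> //; first by rewrite mul_nul FoI quadruple_nablaE.
transitivity ((M ∘ (J ⊗ I ⊗ nu)) ∘ nu); last by planar.
by rewrite rnu mor_compA nabla_idem.
Qed.

End Quadruple.

(** * Crossed products by a measuring *)

Section CrossedProduct.
Variables (C : strict_smc) (H B : C) (aH : algebra H) (cH : coalgebra H).
Variables (aB : algebra B) (phi : mor [:: H; B] [:: B]).
Local Notation I := (\id_H).
Local Notation J := (\id_B).
Local Notation c := (\c_(H, B)).
Local Notation d := (delta cH).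
Local Notation ep := (eps cH).
Local Notation m := (mu aB).
Local Notation e := (eta aB).
Local Notation P := (P_ cH phi).
Local Notation u := (u1 aB phi).

Lemma P_unit : P ∘ (I ⊗ e) = (u ⊗ I) ∘ d.
Proof.
transitivity ((phi ⊗ I) ∘ (I ⊗ (c ∘ (I ⊗ e))) ∘ d).
  rewrite /P_; planar.
rewrite sym_natr braid10 /u1; planar.
Qed.

Lemma P_eps : (J ⊗ ep) ∘ P = phi.
Proof.
transitivity (phi ∘ (I ⊗ ((J ⊗ ep) ∘ c)) ∘ (d ⊗ J)).
  rewrite /P_; planar.
rewrite natl_sym braid01.
transitivity (phi ∘ (((I ⊗ ep) ∘ d) ⊗ J)); first by planar.
rewrite eps_deltar; planar.
Qed.

(** The measuring condition splits [phi(h1, b b')] into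
    [phi(h1, b) phi(h2, b')]; coassociativity regroups the legs of [h]. *)
Lemma P_mul : is_measuring cH aB phi ->
  P ∘ (I ⊗ m) = (m ⊗ I) ∘ (J ⊗ P) ∘ (P ⊗ J).
Proof.
move=> meas.
transitivity ((phi ⊗ I) ∘ (I ⊗ (c ∘ (I ⊗ m))) ∘ (d ⊗ J ⊗ J)).
  rewrite /P_; planar.
rewrite sym_natr braid12.
transitivity (((phi ∘ (I ⊗ m)) ⊗ I) ∘ (I ⊗ J ⊗ c) ∘ (I ⊗ c ⊗ J) ∘ (d ⊗ J ⊗ J)).
  planar.
rewrite meas.
transitivity (((m ∘ (phi ⊗ phi)) ⊗ I) ∘ (I ⊗ J ⊗ I ⊗ c) ∘
  (I ⊗ (braid [:: H; H] [:: B]) ⊗ J) ∘ (((d ⊗ I) ∘ d) ⊗ J ⊗ J)).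
  rewrite braid21; planar.
rewrite deltaA.
transitivity (((m ∘ (phi ⊗ phi)) ⊗ I) ∘ (I ⊗ J ⊗ I ⊗ c) ∘
  (I ⊗ (braid [:: H; H] [:: B] ∘ (d ⊗ J)) ⊗ J) ∘ (d ⊗ J ⊗ J)).
  planar.
rewrite -natl_sym /P_; planar.
Qed.

Variable (s : mor [:: H; H] [:: B]).
Local Notation F := (F_ aH cH s).
Local Notation dd := (delta_tens cH cH).
Local Notation nab := (quadruple_nabla aB P).

Lemma nabla_F_conv :
  nab ∘ F = (m ⊗ I) ∘ (s ⊗ ((u ⊗ I) ∘ d ∘ mu aH)) ∘ dd.
Proof. rewrite quadruple_nablaE P_unit /F_; planar. Qed.

(** By multiplicativity of the coproduct, [s(h1, k1) u((h2 k2)_1) ⊗ (h2 k2)_2] is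
    [s(h1, k1) u(h2 k2) ⊗ h3 k3], where the first two factors form the
    convolution of [s] and [u ∘ mu]. *)
Lemma nabla_F : d ∘ mu aH = (mu aH ⊗ mu aH) ∘ dd ->
  convolution aB dd s (u ∘ mu aH) = s -> nab ∘ F = F.
Proof.
move=> a1 su; rewrite nabla_F_conv a1.
transitivity (((m ∘ (s ⊗ (u ∘ mu aH))) ⊗ mu aH) ∘ ((I ⊗ I ⊗ dd) ∘ dd)).
  planar.
rewrite -delta_tensA.
transitivity ((convolution aB dd s (u ∘ mu aH) ⊗ mu aH) ∘ dd).
  rewrite /convolution; planar.
by rewrite su.
Qed.

Lemma eps_nabla_F : (J ⊗ ep) ∘ nab ∘ F = convolution aB dd s (u ∘ mu aH).
Proof.
rewrite nabla_F_conv.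
transitivity (m ∘ (s ⊗ (u ∘ ((I ⊗ ep) ∘ d) ∘ mu aH)) ∘ dd); first by planar.
rewrite eps_deltar /convolution; planar.
Qed.

Lemma F_eps : d ∘ mu aH = (mu aH ⊗ mu aH) ∘ dd ->
  convolution aB dd s (u ∘ mu aH) = s -> (J ⊗ ep) ∘ F = s.
Proof. by move=> a1 su; rewrite -(nabla_F a1 su) eps_nabla_F. Qed.

End CrossedProduct.

Lemma u2E (C : strict_smc) (H B : C) (aH : algebra H) (aB : algebra B)
  (phi : mor [:: H; B] [:: B]) : u2 aH aB phi = u1 aB phi ∘ mu aH.
Proof. rewrite /u2 /u1; planar. Qed.

Theorem corollary1p20 (C : strict_smc) (splitC : idempotents_split C)
    (H : C) (hH : weak_hopf_algebra H) (B : C) (aB : algebra B)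
    (phi : mor [:: H; B] [:: B]) (phi_measuring : is_measuring hH aB phi)
    (phi_unit : nabla hH aB phi ∘ (\id_B ⊗ eta hH)
                = P_ hH phi ∘ (eta hH ⊗ \id_B))
    (sigma : mor [:: H; H] [:: B])
    (sigma_u2 : convolution aB (delta_tens hH hH) sigma (u2 hH aB phi) = sigma)
    (PF_twisted : twisted_quadruple aB (P_ hH phi) (F_ hH hH sigma))
    (PF_cocycle : cocycle_quadruple aB (P_ hH phi) (F_ hH hH sigma)) :
  [/\ is_associative (crossed_mul hH hH aB phi sigma),
      is_preunit (crossed_mul hH hH aB phi sigma) (nabla hH aB phi)
        (nabla hH aB phi ∘ (eta aB ⊗ eta hH))
    & is_normalized (crossed_mul hH hH aB phi sigma) (nabla hH aB phi)]
  <->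
  [/\ sigma_twisted hH hH aB phi sigma,
      sigma_cocycle hH hH aB phi sigma
    & sigma_normal hH aB phi sigma].
Proof.
have a1 := wha_a1 hH.
rewrite u2E in sigma_u2.
have Pm := P_mul phi_measuring.
have Feps := F_eps a1 sigma_u2.
have Fnab := nabla_F a1 sigma_u2.
have Peps := P_eps hH phi.
have preunitE := preunit_iff_normal Pm Fnab PF_twisted phi_unit.
have normalE : F_ hH hH sigma ∘ (\id_H ⊗ eta hH) = P_ hH phi ∘ (\id_H ⊗ eta aB) /\
   F_ hH hH sigma ∘ (eta hH ⊗ \id_H) = P_ hH phi ∘ (\id_H ⊗ eta aB) <->
   sigma_normal hH aB phi sigma.
  rewrite P_unit; split=> [[Fr Fl]|[sl sr]].
    have eps_u : (\id_B ⊗ eps hH) ∘ (u1 aB phi ⊗ \id_H) ∘ delta hH = u1 aB phi.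
      transitivity (u1 aB phi ∘ ((\id_H ⊗ eps hH) ∘ delta hH)).
        planar.
      rewrite eps_deltar; planar.
    by split; rewrite -{1}Feps -mor_compA ?Fr ?Fl.
  split; rewrite /F_ -mor_compA.
    rewrite (cross_unitr a1 (wha_a3l hH) (wha_a3r hH) sigma_u2).
    by rewrite sr.
  rewrite (cross_unitl a1 (wha_a3l hH) (wha_a3r hH) sigma_u2).
  by rewrite sl.
split=> [[_ /preunitE/normalE norm _]|[_ _ /normalE/preunitE preunit]].
  split=> //.
    have := twisted_counit PF_twisted (eps hH).
    by rewrite Feps Peps.
  have := cocycle_counit PF_cocycle (eps hH).
  by rewrite Feps.
split=> //; first exact: quadruple_mul_assoc.
by split; [exact: nabla_mul|exact: mul_nabla].
Qed.
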